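(* Let $n\ge 2$ and let $\mathbbm{k}$ be a field with $\operatorname{char}(\mathbbm{k})\neq 2$. Let $N=2^{c_{n-1}}$, where $c_m=\binom{m}{2}$, and let $\phi_1,\dots,\phi_N$ be $\mathbb{Z}_2$-twistings of $R=\mathbbm{k}[x_{ij}:1\le i\le j\le n]$ such that \[J_n=\bigcap_{i=1}^N \phi_i(I_n)\] is a prime decomposition of $J_n$ with pairwise distinct components. Fix $l\in[N]$. If $n$ is odd, then \[\bigcap_{i\neq l}\phi_i(I_n)=J_n+\langle \phi_l(p^+_{n,i}) : i\in[n]\rangle,\] where $p^+_{n,i}\in R$ is homogeneous (in the standard grading) of degree $\frac{(n-1)^2}{2}$ and is the generating function of the fiber $V_n^{-1}[\mathbf b_i]$ with $\mathbf b_i=(n-2,\dots,n-2)+e_i$, in the sense that $p^+_{n,i}=\sum x^{\mathbf a}$ where $\mathbf a$ runs over one representative of each equivalence class of $V_n^{-1}[\mathbf b_i]$ modulo $L'_n$. If $n$ is even, then \[\bigcap_{i\neq l}\phi_i(I_n)=J_n+\langle \phi_l(p^+_{n})\rangle,\] where $p^+_n\in R$ is homogeneous of degree $\frac{n(n-2)}{2}$ and is the generating function of the fiber $V_n^{-1}[(n-2,\dots,n-2)]$ in the same sense (one monomial for each equivalence class of the fiber modulo $L'_n$).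
   Context: Let $\mathbbm{k}$ be a field, $n\ge 2$, $[n]=\{1,\dots,n\}$, and $R=\mathbbm{k}[x_{ij}: 1\le i\le j\le n]$ the polynomial ring in $\binom{n+1}{2}$ variables, with the convention $x_{ij}=x_{ji}$; exponent vectors live in $\mathbb{N}^{\binom{n+1}{2}}$ with standard basis $e_{ij}$ ($i\le j$, $e_{ij}=e_{ji}$). $V_n$ is the $n\times\binom{n+1}{2}$ integer matrix whose column indexed by $jk$ is $e_j+e_k\in\mathbb{Z}^n$ (so the $V_n$-degree of $x_{jk}$ is $e_j+e_k$). For $\mathbf b\in\mathbb{N}^n$, the fiber is $V_n^{-1}[\mathbf b]=\{u\in\mathbb{N}^{\binom{n+1}{2}}: V_nu=\mathbf b\}$. $I_n$ is the toric ideal of $V_n$, i.e. the ideal generated by all $2$-minors of the symmetric matrix $(x_{ij})$ (the second Veronese ideal). $J_n$ is the ideal generated by the principal $2$-minors $x_{ii}x_{jj}-x_{ij}^2$, $i,j\in[n]$. For $i,j,k,l\in[n]$ write $[ij|kl]=e_{ik}+e_{jl}-e_{il}-e_{jk}$; $L'_n\subset\mathbb{Z}^{\binom{n+1}{2}}$ is the lattice generated by the vectors $[ij|ij]$, $i,j\in[n]$. Two lattice points of a fiber are equivalent if their difference lies in $L'_n$. A $\mathbb{Z}_2$-twisting is a ring automorphism of $R$ mapping each variable either to itself or to its negative. *)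

(* Defs.v *)
From HB Require Import structures.
From mathcomp Require Import all_boot all_order all_algebra.
From mathcomp Require Import mpoly.

Set Implicit Arguments.
Unset Strict Implicit.
Unset Printing Implicit Defensive.

Import Order.TTheory GRing.Theory Num.Theory.
Local Open Scope ring_scope.

(* Index set of the variables x_ij, 1 <= i <= j <= n (0-based here). *)
Definition VT (n : nat) := {p : 'I_n * 'I_n | (p.1 <= p.2)%N}.

Definition nv (n : nat) : nat := #|{: VT n}|.

Lemma vpair_subproof n (i j : 'I_n) :
  ((if (i <= j)%N then (i, j) else (j, i)).1 <=
   (if (i <= j)%N then (i, j) else (j, i)).2)%N.
Proof. case: (leqP i j) => [//|h] /=; exact: ltnW. Qed.

(* the unordered pair {i,j}, so that x_ij = x_ji *)
Definition vpair n (i j : 'I_n) : VT n :=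
  exist _ (if (i <= j)%N then (i, j) else (j, i)) (vpair_subproof i j).

Definition vidx n (i j : 'I_n) : 'I_(nv n) := enum_rank (vpair i j).

Definition Rpoly (F : fieldType) (n : nat) := {mpoly F[nv n]}.

Definition xv (F : fieldType) n (i j : 'I_n) : Rpoly F n := 'X_(vidx i j).

Definition Vdeg n (u : 'X_{1..nv n}) (k : 'I_n) : nat :=
  (\sum_(p : VT n) u (enum_rank p) * (((val p).1 == k) + ((val p).2 == k)))%N.

Definition in_fiber n (b : 'I_n -> nat) (u : 'X_{1..nv n}) : Prop :=
  forall k, Vdeg u k = b k.

Definition brk n (i j k l : 'I_n) (p : 'I_(nv n)) : int :=
  (vidx i k == p)%:Z + (vidx j l == p)%:Z - (vidx i l == p)%:Z - (vidx j k == p)%:Z.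

Definition equivL n (u v : 'X_{1..nv n}) : Prop :=
  exists c : 'I_n -> 'I_n -> int, forall p : 'I_(nv n),
    (u p)%:Z - (v p)%:Z = \sum_(i < n) \sum_(j < n) c i j * brk i j i j p.

Definition fiber_genfun (F : fieldType) n (b : 'I_n -> nat) (p : Rpoly F n) : Prop :=
  exists S : seq 'X_{1..nv n},
    [/\ uniq S,
        (forall a, a \in S -> in_fiber b a),
        (forall a a', a \in S -> a' \in S -> a != a' -> ~ equivL a a'),
        (forall u, in_fiber b u -> exists2 a, a \in S & equivL u a)
      & p = \sum_(a <- S) 'X_[a]].

Definition ideal_gen (F : fieldType) n (G : Rpoly F n -> Prop) : Rpoly F n -> Prop :=
  fun q => exists l : seq (Rpoly F n * Rpoly F n),
    (forall c, c \in l -> G c.2) /\ q = \sum_(c <- l) c.1 * c.2.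

Definition toric_tuple (F : fieldType) n : (nv n).-tuple {mpoly F[n]} :=
  [tuple 'X_((val (enum_val k)).1) * 'X_((val (enum_val k)).2) | k < nv n].

Definition In (F : fieldType) n : Rpoly F n -> Prop :=
  fun q => comp_mpoly (toric_tuple F n) q = 0.

(* J_n: generated by the principal 2-minors x_ii x_jj - x_ij^2 *)
Definition Jgen (F : fieldType) n (g : Rpoly F n) : Prop :=
  exists i j : 'I_n, g = xv F i i * xv F j j - xv F i j ^+ 2.

Definition Jn (F : fieldType) n : Rpoly F n -> Prop := ideal_gen (@Jgen F n).

Definition twist (F : fieldType) n (s : 'I_(nv n) -> bool) (p : Rpoly F n) : Rpoly F n :=
  comp_mpoly [tuple (-1) ^+ (s k) *: 'X_k | k < nv n] p.

Definition twist_img (F : fieldType) n (s : 'I_(nv n) -> bool)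
  (I : Rpoly F n -> Prop) : Rpoly F n -> Prop :=
  fun q => exists2 p, I p & q = twist s p.

Definition homog_deg (F : fieldType) n (d : nat) (p : Rpoly F n) : bool :=
  p \is ishomog1 d mdeg.

(* Main.v *)
Require Import Defs.
From HB Require Import structures.
From mathcomp Require Import all_boot all_order all_algebra.
From mathcomp Require Import mpoly.
From mathcomp Require Import zify ring.
Import GRing.Theory.
Local Open Scope ring_scope.

Set Implicit Arguments.
Unset Strict Implicit.

(* Read the monomials of a fiber modulo L'_n as graphs on [n] with prescribed degree
   parities, a coset of the cycle space Z of K_n.  In multidegree b, phi_i(I_n)
   consists of the q whose coefficients, weighted by a sign character of the
   monomials, sum to zero, and this character depends only on its restriction to Z.
   Since dim Z = C(n-1,2), the N distinct components realise every character of Z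
   exactly once.

   Hence q lies in all components but the l-th iff its class sums have their Fourier
   transform supported at the l-th character, so that up to sign they are constant
   on the whole coset.  If some b_k < n - 2, a class without monomials in the fiber
   forces this constant to be 0; otherwise every class is attained and the constant
   is matched by a multiple of the twisted generating function of a minimal fiber.
   The difference then lies in every phi_i(I_n), i.e. in J_n. *)

(** * Multidegrees and the lattice *)

Definition end1 n (p : 'I_(nv n)) : 'I_n := (val (enum_val p)).1.
Definition end2 n (p : 'I_(nv n)) : 'I_n := (val (enum_val p)).2.

Lemma end_le n (p : 'I_(nv n)) : (end1 p <= end2 p)%N.
Proof. exact: (valP (enum_val p)). Qed.

Lemma vidx_ends n (p : 'I_(nv n)) : vidx (end1 p) (end2 p) = p.
Proof.
apply: enum_val_inj; rewrite enum_rankK; apply: val_inj => /=.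
by rewrite end_le -surjective_pairing.
Qed.

Lemma vidxP n (p : 'I_(nv n)) :
  exists2 ab : 'I_n * 'I_n, (ab.1 <= ab.2)%N & p = vidx ab.1 ab.2.
Proof. by exists (end1 p, end2 p); rewrite ?vidx_ends //= end_le. Qed.

Lemma end1_vidx n (i j : 'I_n) : (i <= j)%N -> end1 (vidx i j) = i.
Proof. by move=> le_ij; rewrite /end1 enum_rankK /= le_ij. Qed.

Lemma end2_vidx n (i j : 'I_n) : (i <= j)%N -> end2 (vidx i j) = j.
Proof. by move=> le_ij; rewrite /end2 enum_rankK /= le_ij. Qed.

Lemma vidxC n (i j : 'I_n) : vidx i j = vidx j i.
Proof.
congr enum_rank; apply: val_inj => /=.
by case: ltngtP => // /val_inj ->.
Qed.

Lemma vidx_eq n (a b k j : 'I_n) :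
  (vidx a b == vidx k j) = (a == k) && (b == j) || (a == j) && (b == k).
Proof.
apply/eqP/orP => [|[] /andP[/eqP-> /eqP->] //]; last exact: vidxC.
wlog le_ab: a b / (a <= b)%N => [H|].
  case/orP: (leq_total a b) => [|le_ba E]; first exact: H.
  have [] := H _ _ le_ba; first by rewrite vidxC.
    by rewrite andbC; right.
  by rewrite andbC; left.
wlog le_kj: k j / (k <= j)%N => [H|].
  case/orP: (leq_total k j) => [|le_jk E]; first exact: H.
  have [] := H _ _ le_jk; first by rewrite [RHS]vidxC.
    by right.
  by left.
move=> E; left; apply/andP; split; apply/eqP.
  by rewrite -(end1_vidx le_ab) E end1_vidx.
by rewrite -(end2_vidx le_ab) E end2_vidx.
Qed.

Lemma VdegE n (u : 'X_{1..nv n}) k :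
  Vdeg u k = (\sum_p u p * ((end1 p == k) + (end2 p == k)))%N.
Proof.
rewrite /Vdeg [RHS](reindex _ (onW_bij _ (@enum_rank_bij _))) /=.
by apply: eq_bigr => p _; rewrite /end1 /end2 enum_rankK.
Qed.

(** A loop at k has both ends at k but occurs only once among the j, hence the extra term. *)
Lemma ends_incidence n (p : 'I_(nv n)) k :
  ((end1 p == k) + (end2 p == k) =
   \sum_j (vidx k j == p) + (vidx k k == p))%N.
Proof.
case: (vidxP p) => -[a b] /= le_ab ->; rewrite end1_vidx // end2_vidx //.
under eq_bigr => j _ do rewrite vidx_eq.
rewrite vidx_eq !(eq_sym k).
have sum1 (c : 'I_n) : (\sum_j (j == c) = 1)%N.
  by rewrite (bigD1 c) //= eqxx big1 // => j /negbTE ->.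
have [-> | nak] := eqVneq a k; have [-> | nbk] := eqVneq b k => /=.
- by under eq_bigr => j _ do rewrite orbb; rewrite sum1.
- by under eq_bigr => j _ do rewrite orbF; rewrite sum1.
- by rewrite sum1.
- by rewrite big1.
Qed.

Lemma Vdeg_row n (u : 'X_{1..nv n}) k :
  Vdeg u k = (\sum_j u (vidx k j) + u (vidx k k))%N.
Proof.
have pick q : (\sum_p u p * (q == p) = u q)%N.
  rewrite (bigD1 q) //= eqxx muln1 big1 ?addn0 // => p.
  by rewrite eq_sym => /negbTE ->; rewrite muln0.
rewrite VdegE; under eq_bigr => p _ do rewrite ends_incidence mulnDr big_distrr.
rewrite big_split exchange_big /= pick; congr (_ + _)%N.
by apply: eq_bigr => j _; rewrite pick.
Qed.

Lemma VdegD n (u v : 'X_{1..nv n}) k : Vdeg (u + v)%MM k = (Vdeg u k + Vdeg v k)%N.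
Proof.
by rewrite !VdegE -big_split; apply: eq_bigr => p _; rewrite mnmDE mulnDl.
Qed.

Lemma Vdeg_sum n (u : 'X_{1..nv n}) : (\sum_k Vdeg u k = (mdeg u).*2)%N.
Proof.
under eq_bigr => k _ do rewrite VdegE.
rewrite exchange_big mdegE -muln2 big_distrl; apply: eq_bigr => p _ /=.
rewrite -big_distrr big_split /=; congr (_ * _)%N.
by rewrite (bigD1 (end1 p)) //= [X in (_ + X)%N](bigD1 (end2 p)) //= !eqxx
  !big1 // => j; rewrite eq_sym => /negbTE ->.
Qed.

Definition mVdeg n (u : 'X_{1..nv n}) : 'X_{1..n} := [multinom Vdeg u k | k < n].

Lemma mVdegD n (u v : 'X_{1..nv n}) : mVdeg (u + v)%MM = (mVdeg u + mVdeg v)%MM.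
Proof. by apply/mnmP => k; rewrite mnmDE !mnmE VdegD. Qed.

Lemma mdeg_mVdeg n (u : 'X_{1..nv n}) : mdeg (mVdeg u) = (mdeg u).*2.
Proof. by rewrite mdegE -Vdeg_sum; apply: eq_bigr => k _; rewrite mnmE. Qed.

Lemma Vdeg1 n (i j k : 'I_n) : Vdeg U_(vidx i j)%MM k = ((i == k) + (j == k))%N.
Proof.
wlog le_ij: i j / (i <= j)%N => [H|].
  by case/orP: (leq_total i j) => [/H //|le_ji]; rewrite vidxC addnC H.
rewrite VdegE (bigD1 (vidx i j)) //= mnm1E eqxx mul1n end1_vidx // end2_vidx //.
by rewrite big1 ?addn0 // => p; rewrite mnm1E eq_sym => /negbTE ->.
Qed.

(** Two units e_i and e_j are peeled off at a time; together they are the multidegree of x_ij. *)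
Lemma mVdeg_surj n (c : 'X_{1..n}) : ~~ odd (mdeg c) -> exists w, mVdeg w = c.
Proof.
have [d] := ubnP (mdeg c); elim: d c => // d IH c lt_cd even_c.
have peel (e : 'X_{1..n}) : mdeg e != 0 -> exists i e', e = (U_(i) + e')%MM.
  rewrite mdeg_eq0 => nz_e.
  have [i e_i] : exists i, e i != 0.
    apply/existsP; apply: contraNT nz_e => /existsPn e0.
    by apply/eqP/mnmP => i; rewrite mnm0E; apply/eqP; move/negPn: (e0 i).
  exists i, (e - U_(i))%MM; apply/mnmP => j; rewrite mnmDE mnmBE mnm1E.
  by have [<-|] := eqVneq i j; rewrite ?subnKC // ?lt0n // subn0.
have [/eqP|nz_c] := eqVneq (mdeg c) 0.
  rewrite mdeg_eq0 => /eqP->; exists 0%MM; apply/mnmP => k.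
  by rewrite mnmE mnm0E VdegE big1 // => p _; rewrite mnm0E.
have [i [c' Ec]] := peel _ nz_c.
have dc: mdeg c = (mdeg c').+1 by rewrite Ec mdegD mdeg1.
have nz_c': mdeg c' != 0 by apply: contraNneq even_c => c'0; rewrite dc c'0.
have [j [e Ee]] := peel _ nz_c'.
have de: mdeg c' = (mdeg e).+1 by rewrite Ee mdegD mdeg1.
have [||w Ew] := IH e; first by lia.
  by move: even_c; rewrite dc de /= negbK.
exists (U_(vidx i j) + w)%MM; rewrite mVdegD Ew Ec Ee; apply/mnmP => k.
by rewrite !mnmDE mnmE Vdeg1 !mnm1E addnA.
Qed.

(** The vector [ij|ij] is e_ii + e_jj - 2 e_ij, so off the diagonal it has only the even entry at
    ij. *)
Lemma brk_offdiag n (i j a b : 'I_n) : a != b ->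
  brk i j i j (vidx a b) = - (2 * (vidx i j == vidx a b)%:Z).
Proof.
move=> neq_ab; rewrite /brk (vidxC j i).
have diagF (k : 'I_n) : (vidx k k == vidx a b) = false.
  rewrite vidx_eq [X in _ || X]andbC orbb.
  by apply: contraNF neq_ab => /andP[/eqP<- /eqP<-].
rewrite !diagF; lia.
Qed.

Lemma equivL_odd n (u v : 'X_{1..nv n}) (a b : 'I_n) :
  a != b -> equivL u v -> odd (u (vidx a b)) = odd (v (vidx a b)).
Proof.
move=> neq_ab [c /(_ (vidx a b))].
under eq_bigr => i _ do under eq_bigr => j _ do
  rewrite brk_offdiag // mulrN mulrCA -mulrN.
under eq_bigr => i _ do rewrite -mulr_sumr.
rewrite -mulr_sumr; set S := \sum_(_ < _) _; lia.
Qed.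

(** Off the diagonal, half the even difference is the coefficient of each [ab|ab] with a < b, up to
    sign. Equal degrees then force the diagonal entries to agree. *)
Lemma odd_equivL n (u v : 'X_{1..nv n}) :
    (forall k, Vdeg u k = Vdeg v k) ->
    (forall a b : 'I_n, a != b -> odd (u (vidx a b)) = odd (v (vidx a b))) ->
  equivL u v.
Proof.
move=> eqV eq_odd; pose d p : int := (u p)%:Z - (v p)%:Z.
pose h (a b : 'I_n) : int := if (a < b)%N then (d (vidx a b) %/ 2)%Z else 0.
have dE (a b : 'I_n) : (a < b)%N -> d (vidx a b) = 2 * h a b.
  move=> lt_ab; rewrite /h lt_ab /d.
  have := eq_odd a b; rewrite neq_ltn lt_ab => /(_ isT); lia.
exists (fun i j => - h i j) => p; case: (vidxP p) => -[a b] /= le_ab ->.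
rewrite -/(d _); have [Eab | neq_ab] := eqVneq a b; last first.
  have lt_ab: (a < b)%N by rewrite ltn_neqAle le_ab andbT.
  under eq_bigr => i _ do under eq_bigr => j _ do rewrite brk_offdiag // mulrNN.
  rewrite (bigD1 a) //= (bigD1 b) //= eqxx mulr1 !big1 ?addr0 ?dE 1?mulrC //.
    move=> i neq_ia; rewrite big1 // => j _; rewrite /h; case: ifP => [lt_ij|].
      rewrite vidx_eq (negbTE neq_ia) /=.
      have -> : (i == b) && (j == a) = false.
        by apply/andP => -[/eqP Ei /eqP Ej]; move: lt_ij; rewrite Ei Ej ltnNge le_ab.
      by rewrite !mulr0.
    by rewrite mul0r.
  move=> j neq_jb; rewrite vidx_eq (negbTE neq_jb) (negbTE neq_ab) andbF.
  by rewrite /= !mulr0.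
subst b; clear le_ab.
(* The degree at [a] counts the loop twice: once within the row and once more. *)
have drow : \sum_j d (vidx a j) + d (vidx a a) = 0.
  rewrite /d sumrB addrACA -opprD.
  have := eqV a; rewrite !Vdeg_row => E.
  rewrite -[X in X - _](_ : ((\sum_j u (vidx a j) + u (vidx a a))%N%:Z = _)).
    rewrite -[X in _ - X](_ : ((\sum_j v (vidx a j) + v (vidx a a))%N%:Z = _)).
      by rewrite E subrr.
    by rewrite PoszD -!natz natr_sum natz; under eq_bigr => i _ do rewrite natz.
  by rewrite PoszD -!natz natr_sum natz; under eq_bigr => i _ do rewrite natz.
have brkE (i j : 'I_n) :
    - h i j * brk i j i j (vidx a a) = - h i j * (i == a)%:Z - h i j * (j == a)%:Z.
  have E (k l : 'I_n) : (vidx k l == vidx a a) = (k == a) && (l == a).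
    by rewrite vidx_eq orbb.
  rewrite /brk !E !andbb [(j == a) && _]andbC /h.
  case: ifP => [lt_ij|]; last by rewrite !oppr0 !mul0r.
  have -> : (i == a) && (j == a) = false.
    by apply/andP => -[/eqP Ei /eqP Ej]; move: lt_ij; rewrite Ei Ej ltnn.
  by rewrite !subr0 mulrDr !mulNr.
under eq_bigr => i _ do under eq_bigr => j _ do rewrite brkE.
have -> : \sum_(i < n) \sum_(j < n) (- h i j * (i == a)%:Z - h i j * (j == a)%:Z)
    = - \sum_j (h a j + h j a).
  under eq_bigr => i _ do rewrite sumrB.
  rewrite sumrB [X in X - _](bigD1 a) //= eqxx [X in _ + X - _]big1 ?addr0; last first.
    by move=> i /negbTE ->; rewrite big1 // => j _; rewrite mulr0.
  rewrite big_split opprD /=; congr (_ - _).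
    by rewrite -sumrN; apply: eq_bigr => j _; rewrite mulr1.
  apply: eq_bigr => i _; rewrite (bigD1 a) //= eqxx mulr1 big1 ?addr0 //.
  by move=> j /negbTE ->; rewrite mulr0.
have -> : \sum_j (h a j + h j a) = - d (vidx a a); last by rewrite opprK.
suff: 2 * \sum_j (h a j + h j a) = - (2 * d (vidx a a)) by lia.
rewrite mulr_sumr (bigD1 a) //= {1 2}/h ltnn addr0 mulr0 add0r.
move: drow; rewrite (bigD1 a) //= => drow.
(* [h] vanishes unless its first index is the smaller one, so each edge at [a] is counted once. *)
rewrite (eq_bigr (fun j => d (vidx a j))); last first.
  move=> j; rewrite neq_ltn => /orP[] lt_aj.
    by rewrite vidxC dE // /h [in X in _ * (X + _)]ltnNge (ltnW lt_aj) /= add0r.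
  by rewrite dE // /h [in X in _ * (_ + X)]ltnNge (ltnW lt_aj) /= addr0.
by set S := \sum_(_ < _ | _) _ in drow *; lia.
Qed.

(** * Parities in a fiber *)

(* The edges of K_n that avoid the vertex [r]; the triangles they span with [r]
   form a basis of the cycle space of K_n. *)
Definition rim n (r : 'I_n) : {set 'I_(nv n)} :=
  [set p | [&& end1 p != end2 p, end1 p != r & end2 p != r]].

Lemma in_rim n (r : 'I_n) p :
  (p \in rim r) = [&& end1 p != end2 p, end1 p != r & end2 p != r].
Proof. exact: in_set. Qed.

Lemma vidx_rim n (r a b : 'I_n) :
  (vidx a b \in rim r) = [&& a != b, a != r & b != r].
Proof.
wlog le_ab: a b / (a <= b)%N => [H|].
  case/orP: (leq_total a b) => [/H //|le_ba]; rewrite vidxC H // eq_sym.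
  by rewrite [X in _ && X]andbC.
by rewrite in_rim end1_vidx // end2_vidx.
Qed.

(** Edges of the rim are pairs in the complement of [r]. This bound makes N distinct subsets of the
    rim exhaust its powerset. *)
Lemma card_rim n (r : 'I_n) : (#|rim r| <= 'C(n.-1, 2))%N.
Proof.
pose ends (p : 'I_(nv n)) := [set end1 p; end2 p].
have ends_inj : {in rim r &, injective ends}.
  move=> p q _ _ eq_pq; rewrite -(vidx_ends p) -(vidx_ends q).
  have /andP[] : (end1 p \in ends q) && (end2 p \in ends q).
    by rewrite -eq_pq !inE !eqxx orbT.
  have /andP[] : (end1 q \in ends p) && (end2 q \in ends p).
    by rewrite eq_pq !inE !eqxx orbT.
  rewrite !inE => /orP[]/eqP E1 /orP[]/eqP E2 /orP[]/eqP E3 /orP[]/eqP E4;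
    first [congruence | rewrite vidxC; congruence].
rewrite -(card_in_imset ends_inj).
have -> : n.-1 = #|[set~ r]| by rewrite cardsC1 card_ord.
rewrite -cards_draws; apply/subset_leq_card/subsetP => _ /imsetP[p p_r ->].
move: p_r; rewrite in_rim => /and3P[neq_ends n1 n2].
rewrite inE /ends cards2 neq_ends andbT.
by apply/subsetP => x; rewrite !inE => /orP[] /eqP->.
Qed.

Definition odd_rim n (r : 'I_n) (u : 'X_{1..nv n}) : {set 'I_(nv n)} :=
  [set p in rim r | odd (u p)].

Lemma in_odd_rim n (r : 'I_n) u p :
  (p \in odd_rim r u) = (p \in rim r) && odd (u p).
Proof. exact: in_set. Qed.

(** Loops add an even number to a degree, so the degree of a vertex b and the parities on the rim
    determine the parity on the spoke br. *)
Lemma odd_rimP n (r : 'I_n) (u v : 'X_{1..nv n}) :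
    (forall k, Vdeg u k = Vdeg v k) ->
  reflect (equivL u v) (odd_rim r u == odd_rim r v).
Proof.
move=> eqV; apply: (iffP eqP) => [eq_rim|eq_uv]; last first.
  apply/setP => p; rewrite !in_odd_rim in_rim; case: eqVneq => //= n12.
  by have := equivL_odd n12 eq_uv; rewrite vidx_ends => ->.
have odd_in a b : a != b -> a != r -> b != r ->
    odd (u (vidx a b)) = odd (v (vidx a b)).
  move=> nab nar nbr; have /setP/(_ (vidx a b)) := eq_rim.
  by rewrite !in_odd_rim vidx_rim nab nar nbr.
have odd_spoke b : b != r -> odd (u (vidx b r)) = odd (v (vidx b r)).
  move=> nbr; have row w : odd (Vdeg w b) = odd (w (vidx b r)) (+)
      \big[addb/false]_(j | (j != b) && (j != r)) odd (w (vidx b j)).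
    rewrite Vdeg_row (bigD1 b) //= addnAC addnn oddD odd_double addFb.
    by rewrite (bigD1 r) 1?eq_sym //= oddD (big_morph odd oddD erefl).
  have := congr1 odd (eqV b); rewrite !row.
  under eq_bigr => j /andP[njb njr] do rewrite odd_in // 1?eq_sym //.
  by move/addIb.
apply: odd_equivL => // a b nab.
have [Ea|nar] := eqVneq a r; first by rewrite Ea vidxC odd_spoke // -Ea eq_sym.
by have [->|nbr] := eqVneq b r; [apply: odd_spoke | apply: odd_in].
Qed.

(* Exactly the fibers that meet every class modulo the parities of the edges. *)
Definition large_fiber n (b : 'I_n -> nat) : Prop :=
  (forall k, n - 2 <= b k)%N /\ ~~ odd (\sum_k b k)%N.

(** The edges of A are completed by spokes at [r] to a simple graph with the degree parities of b;
    loops then supply the missing degrees two at a time. *)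
Lemma large_fiber_odd_rim n (r : 'I_n) (b : 'I_n -> nat) (A : {set 'I_(nv n)}) :
  large_fiber b -> A \subset rim r -> exists2 u, in_fiber b u & odd_rim r u = A.
Proof.
move=> [ge_b even_b] sAr.
have A_pair j k : vidx j k \in A -> [&& j != k, j != r & k != r].
  by move/(subsetP sAr); rewrite vidx_rim.
pose u1 : 'X_{1..nv n} := [multinom (p \in A : nat) | p < nv n].
pose f j := (j != r) && odd (b j + Vdeg u1 j).
pose u2 : 'X_{1..nv n} :=
  [multinom ((end1 p == r) && f (end2 p) || (end2 p == r) && f (end1 p) : nat)
    | p < nv n].
have u2E j k : u2 (vidx j k) = (j == r) && f k || (k == r) && f j.
  wlog le_jk: j k / (j <= k)%N => [H|].
    by case/orP: (leq_total j k) => [/H //|le_kj]; rewrite vidxC H // orbC.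
  by rewrite mnmE end1_vidx // end2_vidx.
pose w := (u1 + u2)%MM.
have wE j k : w (vidx j k) =
    ((vidx j k \in A) + ((j == r) && f k || (k == r) && f j))%N.
  by rewrite mnmDE u2E mnmE.
have w_diag j : w (vidx j j) = 0%N.
  have /negbTE AjjF: vidx j j \notin A by apply/negP => /A_pair; rewrite eqxx.
  by rewrite wE orbb AjjF /f; case: (j == r).
have w_le1 j k : (w (vidx j k) <= 1)%N.
  rewrite wE; case: (boolP (_ \in A)) => [/A_pair/and3P[_ /negbTE-> /negbTE->]|_] //.
  by case: (_ || _).
have Vw_le j : (Vdeg w j <= n.-1)%N.
  rewrite Vdeg_row w_diag addn0 (bigD1 j) //= w_diag add0n.
  apply: (leq_trans (leq_sum _ (fun k _ => w_le1 j k))).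
  by rewrite sum1_card cardC1 card_ord.
have odd_w j : j != r -> odd (Vdeg w j) = odd (b j).
  move=> njr; rewrite VdegD.
  have -> : Vdeg u2 j = f j.
    rewrite Vdeg_row u2E (negbTE njr) /= addn0 (bigD1 r) //= u2E eqxx andTb.
    rewrite (negbTE njr) /= big1 ?addn0 // => k nkr.
    by rewrite u2E (negbTE njr) (negbTE nkr).
  by rewrite oddD oddb /f njr oddD addbCA addbb addbF.
(* At [r] the parity follows from the other vertices, both degree sums being even. *)
have odd_wr j : odd (Vdeg w j) = odd (b j).
  have [->|/odd_w //] := eqVneq j r.
  have odd_sum (F : 'I_n -> nat) : odd (\sum_k F k)%N =
      odd (F r) (+) \big[addb/false]_(k | k != r) odd (F k).
    by rewrite (bigD1 r) //= oddD (big_morph odd oddD erefl).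
  have := congr1 odd (Vdeg_sum w); rewrite odd_double odd_sum (eq_bigr _ odd_w).
  by move: even_b; rewrite odd_sum => /negbTE E1 E2; apply: addIb (etrans E2 (esym E1)).
(* Degrees of [w] are at most n - 1, and parity excludes n - 1 when b_j = n - 2. *)
have Vw_leb j : (Vdeg w j <= b j)%N.
  by have := odd_wr j; have := Vw_le j; have := ge_b j; lia.
pose d : 'X_{1..nv n} :=
  [multinom ((end1 p == end2 p) * (b (end1 p) - Vdeg w (end1 p))./2)%N | p < nv n].
have dE j k : d (vidx j k) = ((j == k) * (b j - Vdeg w j)./2)%N.
  wlog le_jk: j k / (j <= k)%N => [H|].
    case/orP: (leq_total j k) => [/H //|le_kj]; rewrite vidxC H // eq_sym.
    by case: eqP => [->|].
  by rewrite mnmE end1_vidx // end2_vidx.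
exists (w + d)%MM => [j|].
  rewrite VdegD [Vdeg d _]Vdeg_row dE eqxx (bigD1 j) //= dE eqxx.
  rewrite big1 => [|k nkj]; last by rewrite dE eq_sym (negbTE nkj).
  by have := odd_wr j; have := Vw_leb j; lia.
apply/setP => p; rewrite in_odd_rim; case: (boolP (p \in rim r)) => [|pNr].
  rewrite -(vidx_ends p) vidx_rim => /and3P[/negbTE n12 /negbTE n1 /negbTE n2].
  by rewrite mnmDE dE wE n12 n1 n2 /= !addn0 oddb.
by apply/esym/negbTE; apply: contra pNr => /(subsetP sAr).
Qed.

(** * Sign characters *)

Lemma prod_subsets (R : comNzRingType) (I : finType) (E : {set I}) (z : I -> R) :
  \sum_(T : {set I} | T \subset E) \prod_(p in T) z p = \prod_(p in E) (1 + z p).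
Proof.
(* Extending z by 0 off E kills the subsets not contained in E when the product over all of I is
   expanded. *)
pose y p := if p \in E then z p else 0.
transitivity (\prod_p (y p + 1)); last first.
  rewrite [RHS]big_mkcond; apply: eq_bigr => p _; rewrite /y addrC.
  by case: ifP; rewrite ?addr0.
rewrite bigA_distr big_mkcond; apply: eq_bigr => T _; rewrite -big_mkcond /=.
case: ifP => [sTE|/negbT/subsetPn[p pT pNE]].
  by apply: eq_bigr => p pT; rewrite /y (subsetP sTE).
by rewrite (bigD1 p) //= /y (negbTE pNE) mul0r.
Qed.

Section Signs.
Variables (F : fieldType) (n : nat).
Implicit Types (s : 'I_(nv n) -> bool) (u v : 'X_{1..nv n}) (q : Rpoly F n).
Implicit Types (T : {set 'I_(nv n)}) (r : 'I_n).

Definition sgn s u : F := \prod_p ((-1) ^+ s p) ^+ u p.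

Lemma sgnM s u : sgn s u * sgn s u = 1.
Proof.
rewrite /sgn -big_split big1 // => p _ /=.
by rewrite -exprMn -signr_addb addbb expr1n.
Qed.

Lemma twistX s u : twist s 'X_[u] = sgn s u *: 'X_[u] :> Rpoly F n.
Proof.
rewrite /twist comp_mpolyX [in RHS]mpolyXE_id -scaler_prod.
by apply: eq_bigr => p _; rewrite tnth_mktuple exprZn.
Qed.

Lemma toricX u : 'X_[u] \mPo toric_tuple F n = 'X_[mVdeg u].
Proof.
rewrite comp_mpolyX.
under eq_bigr => p _ do rewrite tnth_mktuple -mpolyXD mpolyXn.
rewrite mprodXE; congr 'X_[_]; apply/mnmP => k; rewrite mnm_sumE mnmE VdegE.
by apply: eq_bigr => p _; rewrite mulmnE mnmDE !mnm1E mulnC.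
Qed.

(** As a twisting is its own inverse, the kernel of [psi s] is the image of I_n under it. *)
Definition psi s q : {mpoly F[n]} := twist s q \mPo toric_tuple F n.

Lemma psiX s u : psi s 'X_[u] = sgn s u *: 'X_[mVdeg u].
Proof. by rewrite /psi twistX comp_mpolyZ toricX. Qed.

Lemma psiD s : {morph psi s : p q / p + q}.
Proof. by move=> p q; rewrite /psi /twist !rmorphD. Qed.

Lemma psiB s : {morph psi s : p q / p - q}.
Proof. by move=> p q; rewrite /psi /twist !rmorphB. Qed.

Lemma psiM s : {morph psi s : p q / p * q}.
Proof. by move=> p q; rewrite /psi /twist !rmorphM. Qed.

Lemma psiZ s c q : psi s (c *: q) = c *: psi s q.
Proof. by rewrite /psi /twist !comp_mpolyZ. Qed.

Lemma psi_sum s (I : Type) (l : seq I) (G : I -> Rpoly F n) :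
  psi s (\sum_(i <- l) G i) = \sum_(i <- l) psi s (G i).
Proof.
by apply: (big_morph _ (psiD s)); rewrite -[0 in LHS](scale0r 0) psiZ scale0r.
Qed.

Lemma coef_psi s q b :
  (psi s q)@_b = \sum_(u <- msupp q | mVdeg u == b) q@_u * sgn s u.
Proof.
rewrite [in LHS](mpolyE q) psi_sum raddf_sum [RHS]big_mkcond; apply: eq_bigr => u _.
rewrite /= psiZ psiX !mcoeffZ mcoeffX.
by case: eqP; rewrite ?mulr1 ?mulr0.
Qed.

Lemma twistK s : involutive (@twist F n s).
Proof.
move=> q; rewrite [in LHS](mpolyE q) [RHS]mpolyE.
have sumE := big_morph (twist s) (comp_mpolyD _) (comp_mpoly0 _).
rewrite 2!(sumE _ _ (msupp q)); apply: eq_bigr => u _.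
have twistZ c p : twist s (c *: p) = c *: twist s p by apply: comp_mpolyZ.
by rewrite !(twistZ, twistX) !scalerA -mulrA sgnM mulr1.
Qed.

Lemma twist_imgE s q : twist_img s (@In F n) q <-> psi s q = 0.
Proof.
split=> [[p Ip ->]|]; first by rewrite /psi twistK.
by exists (twist s q); rewrite ?twistK.
Qed.

Lemma ideal_gen_psi0 s (G : Rpoly F n -> Prop) :
  (forall g, G g -> psi s g = 0) -> forall q, ideal_gen G q -> psi s q = 0.
Proof.
move=> G0 q [l [lG ->]]; rewrite psi_sum big_seq big1 // => c /lG/G0 E.
by rewrite psiM E mulr0.
Qed.

Definition chi T u : F := \prod_(p in T) (-1) ^+ u p.

(* The value of [s] on the triangles [r j k]. *)
Definition rim_sign s r : {set 'I_(nv n)} :=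
  [set p in rim r |
    s p (+) s (vidx r (end1 p)) (+) s (vidx r (end2 p)) (+) s (vidx r r)].

(** The exponent [(mdeg b)./2] is the standard degree of any monomial of multidegree b. *)
Definition deg_sign s r (b : 'X_{1..n}) : F :=
  ((-1) ^+ s (vidx r r)) ^+ (mdeg b)./2 *
  \prod_k ((-1) ^+ (s (vidx r k) (+) s (vidx r r))) ^+ b k.

Lemma rim_sign_sub s r : rim_sign s r \subset rim r.
Proof. by apply/subsetP => p; rewrite in_set => /andP[]. Qed.

Lemma deg_sign_neq0 s r b : deg_sign s r b != 0.
Proof.
apply: mulf_neq0; first by rewrite expf_neq0 ?signr_eq0.
by rewrite prodf_seq_neq0; apply/allP => k _; rewrite expf_neq0 ?signr_eq0.
Qed.

(* Off the rim, [s] is the sum of the coboundary of [k |-> s_rk + s_rr] and the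
   constant [s_rr], and the signs of both depend on the multidegree alone. *)
Lemma sgnE s r u : (forall k, s (vidx k k) = s (vidx r r)) ->
  sgn s u = deg_sign s r (mVdeg u) * chi (rim_sign s r) u.
Proof.
move=> diag; pose c := s (vidx r r); pose a k := s (vidx r k) (+) c.
(* On the rim this is the definition of [rim_sign]. On a loop the coboundary cancels and [diag]
   applies; on a spoke [a r] is false. *)
have split_s p : s p = c (+) (a (end1 p) (+) a (end2 p)) (+) (p \in rim_sign s r).
  rewrite in_set; case: (boolP (p \in rim r)) => [_|].
    by rewrite /a -/c; case: (s p); case: (c); case: (s _); case: (s _).
  rewrite in_rim !negb_and !negbK addbF => /or3P[]/eqP E.
  - by rewrite -(vidx_ends p) E diag -/c end1_vidx // end2_vidx // addbb addbF.
  - by rewrite -{1}(vidx_ends p) E /a -/c; case: (c); case: (s _).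
  - by rewrite -{1}(vidx_ends p) E vidxC /a -/c; case: (c); case: (s _).
rewrite /sgn; under eq_bigr => p _ do rewrite split_s 3!signr_addb !exprMn.
rewrite !big_split /= -!mulrA; congr (_ * _).
  by rewrite prodrXr -mdegE mdeg_mVdeg doubleK.
rewrite mulrA; congr (_ * _).
  (* Regrouping by vertices: each edge contributes at both ends, so k receives its sign [Vdeg u k]
     times. *)
  rewrite -big_split /=.
  under [RHS]eq_bigr => k _ do rewrite mnmE VdegE -prodrXr.
  rewrite exchange_big /=; apply: eq_bigr => p _.
  under eq_bigr => k _ do rewrite mulnC mulnDl exprD.
  rewrite big_split (bigD1 (end1 p)) //= eqxx mul1n big1 ?mulr1; last first.
    by move=> k; rewrite eq_sym => /negbTE ->.
  rewrite [X in _ = _ * X](bigD1 (end2 p)) //= eqxx mul1n big1 ?mulr1 //.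
  by move=> k; rewrite eq_sym => /negbTE ->.
rewrite /chi [RHS]big_mkcond; apply: eq_bigr => p _.
by case: (p \in _); rewrite ?expr1n.
Qed.

End Signs.

(** * Ideals and orthogonality of characters *)

Lemma ideal_gen_mono (F : fieldType) n (G G' : Rpoly F n -> Prop) q :
  (forall g, G g -> G' g) -> ideal_gen G q -> ideal_gen G' q.
Proof. by move=> GG' [l [lG ->]]; exists l; split=> // c /lG/GG'. Qed.

Lemma ideal_gen_mull (F : fieldType) n (G : Rpoly F n -> Prop) a g :
  G g -> ideal_gen G (a * g).
Proof.
move=> Gg; exists [:: (a, g)]; split; last by rewrite big_seq1.
by move=> c; rewrite inE => /eqP->.
Qed.

Lemma ideal_genD (F : fieldType) n (G : Rpoly F n -> Prop) p q :
  ideal_gen G p -> ideal_gen G q -> ideal_gen G (p + q).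
Proof.
move=> [l [lG ->]] [l' [lG' ->]]; exists (l ++ l'); rewrite big_cat; split=> // c.
by rewrite mem_cat => /orP[/lG|/lG'].
Qed.

Section Pairing.
Variables (F : fieldType) (I : finType).
Implicit Types A B E T : {set I}.

(** The sign (-1)^#|A :&: T|: the character attached to A of the group of subsets, evaluated at
    T. *)
Definition pairing A T : F := \prod_(p in T) (-1) ^+ (p \in A).

Lemma pairingC A T : pairing A T = pairing T A.
Proof.
rewrite /pairing big_mkcond [RHS]big_mkcond; apply: eq_bigr => p _.
by case: (p \in A); case: (p \in T).
Qed.

(** The sum factors over E: an element where A and B differ gives 1 - 1 = 0, and every other one
    gives 2. *)
Lemma pairing_orthogonal E A B : A \subset E -> B \subset E ->
  \sum_(T : {set I} | T \subset E) pairing A T * pairing B T =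
  if A == B then 2 ^+ #|E| else 0.
Proof.
move=> sAE sBE; under eq_bigr => T _ do rewrite -big_split /=.
rewrite prod_subsets; case: eqVneq => [->|neq_AB].
  under eq_bigr => p _ do rewrite -signr_addb addbb.
  by rewrite prodr_const.
have [p pE neq_p] : exists2 p, p \in E & (p \in A) != (p \in B).
  apply/exists_inP; apply: contraNT neq_AB => /exists_inPn eq_in.
  apply/eqP/setP => p; case: (boolP (p \in E)) => [/eq_in/negPn/eqP //|pNE].
  by rewrite !(negbTE (contra (subsetP _ p) pNE)).
by rewrite (bigD1 p) //= -signr_addb -negb_eqb neq_p expr1 subrr mul0r.
Qed.

End Pairing.

(** * Twisted toric ideals as kernels of Fourier coefficients *)

Section Kernels.
Variables (F : fieldType) (n : nat) (r : 'I_n).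
Implicit Types (s t : 'I_(nv n) -> bool) (u : 'X_{1..nv n}) (q : Rpoly F n).

Lemma chiE (T : {set 'I_(nv n)}) u : T \subset rim r ->
  chi F T u = pairing F (odd_rim r u) T.
Proof.
move=> sTr; apply: eq_bigr => p /(subsetP sTr) p_r.
by rewrite in_odd_rim p_r signr_odd.
Qed.

(** The Fourier coefficient at T of the class sums of q in multidegree b. *)
Definition rim_coef (T : {set 'I_(nv n)}) q b : F :=
  \sum_(u <- msupp q | mVdeg u == b) q@_u * chi F T u.

Definition diag_const s := forall k, s (vidx k k) = s (vidx r r).

Lemma coef_psi_rim s q b : diag_const s ->
  (psi s q)@_b = deg_sign F s r b * rim_coef (rim_sign s r) q b.
Proof.
move=> ds; rewrite coef_psi big_distrr; apply: eq_bigr => u /eqP Vu /=.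
by rewrite (sgnE _ _ ds) Vu mulrCA.
Qed.

Lemma psi_eq0_rim s q : diag_const s ->
  psi s q = 0 <-> forall b, rim_coef (rim_sign s r) q b = 0.
Proof.
move=> ds; split=> [q0 b|q0]; last first.
  by apply/mpolyP => b; rewrite coef_psi_rim // q0 mulr0 mcoeff0.
apply/eqP; have := coef_psi_rim q b ds; rewrite q0 mcoeff0 => /esym/eqP.
by rewrite mulf_eq0 (negbTE (deg_sign_neq0 _ _ _ _)).
Qed.

(** Fourier inversion: by orthogonality the left side is 2^#|rim r| times the class sum of q at A,
    here an empty sum. *)
Lemma rim_coef_inversion (A : {set 'I_(nv n)}) q b : A \subset rim r ->
    (forall u, mVdeg u = b -> odd_rim r u != A) ->
  \sum_(T : {set 'I_(nv n)} | T \subset rim r) pairing F A T * rim_coef T q b = 0.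
Proof.
move=> sAr NA; under eq_bigr => T _ do rewrite big_distrr /=.
rewrite exchange_big big1 //= => u /eqP/NA neq_uA.
under eq_bigr => T sTr do rewrite chiE // mulrCA.
rewrite -mulr_sumr pairing_orthogonal //; last first.
  by apply/subsetP => p; rewrite in_odd_rim => /andP[].
by rewrite eq_sym (negbTE neq_uA) mulr0.
Qed.

(** A large fiber meets every class, so P has one monomial for each subset of the rim and the
    coefficient is a complete character sum. *)
Lemma psi_twist_genfun s t b P :
    diag_const s -> diag_const t -> large_fiber b -> fiber_genfun b P ->
  psi s (twist t P) = (deg_sign F s r [multinom b k | k < n] *
    deg_sign F t r [multinom b k | k < n] *
    (if rim_sign s r == rim_sign t r then 2 ^+ #|rim r| else 0)) *:
    'X_[[multinom b k | k < n]].
Proof.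
move=> ds dt bL [S [uS S_b neqS S_cover ->]].
have VS a : a \in S -> mVdeg a = [multinom b k | k < n].
  by move/S_b => ab; apply/mnmP => k; rewrite !mnmE ab.
have sum_twist := big_morph (@twist F n t) (comp_mpolyD _) (comp_mpoly0 _).
rewrite sum_twist psi_sum; set B := [multinom b k | k < n] in VS *.
transitivity (\sum_(a <- S) (deg_sign F s r B * deg_sign F t r B *
    (pairing F (rim_sign s r) (odd_rim r a) *
     pairing F (rim_sign t r) (odd_rim r a))) *: 'X_[B] : {mpoly F[n]}).
  apply: eq_big_seq => a aS; rewrite twistX psiZ psiX (VS _ aS) scalerA.
  rewrite (sgnE F a ds) (sgnE F a dt) (VS _ aS) !(pairingC _ (rim_sign _ _)).
  rewrite -!chiE ?rim_sign_sub //; congr (_ *: _); ring.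
rewrite -scaler_suml -big_distrr /=; congr (_ * _ *: _).
pose G A := pairing F (rim_sign s r) A * pairing F (rim_sign t r) A.
(* [odd_rim r] maps S bijectively onto the subsets of the rim. *)
rewrite -(big_map (odd_rim r) xpredT G) -(pairing_orthogonal F (E := rim r));
  try exact: rim_sign_sub.
rewrite -[RHS]big_enum; apply: perm_big; apply: uniq_perm.
- rewrite map_inj_in_uniq // => a a' aS a'S eq_aa'; apply/eqP.
  apply: contraT => /(neqS _ _ aS a'S); case; apply/(odd_rimP r).
    by move=> k; rewrite (S_b _ aS) (S_b _ a'S).
  exact/eqP.
- exact: enum_uniq.
move=> A; rewrite mem_enum; apply/mapP/idP => [[a aS ->]|sAr].
  by apply/subsetP => p; rewrite in_odd_rim => /andP[].
have [u ub oA] := large_fiber_odd_rim bL sAr.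
have [a aS eq_ua] := S_cover u ub; exists a => //.
rewrite -oA; apply/eqP/(odd_rimP r) => // k; by rewrite ub (S_b _ aS).
Qed.

End Kernels.

(** * The components of J_n and the intersection of all but one *)

Section MinimalPrimes.
Variables (F : fieldType) (n : nat).
Hypotheses (n_ge2 : (2 <= n)%N) (char_neq2 : ~~ (2%N \in [pchar F])).
Variable phi : 'I_(2 ^ 'C(n.-1, 2)) -> 'I_(nv n) -> bool.
Hypothesis Jn_decomp :
  forall q, Jn q <-> (forall i, twist_img (phi i) (@In F n) q).
Hypothesis phi_distinct : forall i j, i != j ->
  ~ (forall q, twist_img (phi i) (@In F n) q <-> twist_img (phi j) (@In F n) q).

Lemma two_neq0 : (2 : F) != 0.
Proof. by move: char_neq2; rewrite inE. Qed.

Lemma Jn_psi i (q : Rpoly F n) : Jn q -> psi (phi i) q = 0.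
Proof. by move/Jn_decomp/(_ i)/twist_imgE. Qed.

Lemma Jgen_psi i (g : Rpoly F n) : Jgen g -> psi (phi i) g = 0.
Proof. by move=> Jg; apply: Jn_psi; rewrite -[g]mul1r; apply: ideal_gen_mull. Qed.

Lemma sgn1 s (p : 'I_(nv n)) : sgn F s U_(p)%MM = (-1) ^+ s p.
Proof.
rewrite /sgn (bigD1 p) //= mnm1E eqxx big1 ?mulr1 // => p' neq_p.
by rewrite mnm1E eq_sym (negbTE neq_p).
Qed.

(** The component contains x_kk x_rr - x_kr^2. A twisting fixes x_kr^2, so the signs of x_kk and
    x_rr agree in characteristic other than 2. *)
Lemma phi_diag r i : diag_const r (phi i).
Proof.
move=> k; set s := phi i.
have /(Jgen_psi i) : Jgen (xv F k k * xv F r r - xv F k r ^+ 2) by exists k, r.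
rewrite -/s psiB expr2 !psiM !psiX !sgn1 -!scalerAr -!scalerAl !scalerA -!mpolyXD.
have -> : (mVdeg U_(vidx k r) + mVdeg U_(vidx k r) =
           mVdeg U_(vidx k k) + mVdeg U_(vidx r r))%MM.
  by apply/mnmP => j; rewrite !mnmDE !mnmE !Vdeg1; lia.
rewrite -scalerBl -!signr_addb addbb => /(congr1 (mcoeff (mVdeg U_(vidx k k)
  + mVdeg U_(vidx r r))))/eqP.
rewrite mcoeffZ mcoeffX eqxx mulr1 mcoeff0 subr_eq0.
case: (s _); case: (s _) => //=; rewrite expr1 expr0 eq_sym -subr_eq0 opprK;
by rewrite -[1 + 1]/(2 : F) (negbTE two_neq0).
Qed.

(** By [psi_eq0_rim] a component is determined by its [rim_sign]. *)
Lemma rim_sign_inj r : injective (fun i => rim_sign (phi i) r).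
Proof.
move=> i j /= eq_ij; apply/eqP; apply: contraT => /phi_distinct[] q.
by split=> /twist_imgE/(psi_eq0_rim _ (phi_diag r _)) q0;
  apply/twist_imgE/(psi_eq0_rim _ (phi_diag r _)); [rewrite -eq_ij | rewrite eq_ij].
Qed.

(** Counting: N distinct sign sets lie in a powerset of at most N elements. *)
Lemma rim_sign_surj r (T : {set 'I_(nv n)}) : T \subset rim r -> exists i, rim_sign (phi i) r = T.
Proof.
move=> sTr; pose im := [set rim_sign (phi i) r | i in setT].
have : T \in im; last by case/imsetP => i _ ->; exists i.
suff -> : im = powerset (rim r) by rewrite inE.
apply/eqP; rewrite eqEcard card_powerset card_imset; last exact: rim_sign_inj.
rewrite cardsT card_ord leq_exp2l // card_rim andbT.
by apply/subsetP => _ /imsetP[i _ ->]; rewrite inE rim_sign_sub.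
Qed.

Variable l : 'I_(2 ^ 'C(n.-1, 2)).

(** If b_k < n - 2, some class has no monomial of multidegree b. Inversion at that class retains
    only the l-th Fourier coefficient, which must therefore vanish. *)
Lemma psi_supp_large (q : Rpoly F n) :
    (forall i, i != l -> psi (phi i) q = 0) ->
  forall b, b \in msupp (psi (phi l) q) -> large_fiber b.
Proof.
move=> q0 b b_supp; split; last first.
  have : (psi (phi l) q)@_b != 0 by rewrite -mcoeff_msupp.
  rewrite coef_psi; case: (boolP (has (fun u => mVdeg u == b) (msupp q))).
    by case/hasP => u _ /eqP<- _; rewrite -mdegE mdeg_mVdeg odd_double.
  by move=> noU; rewrite [X in X != 0]big_hasC ?eqxx.
move=> k; rewrite leqNgt; apply/negP => lt_bk.
have [r nrk] : exists r, r != k.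
  have /card_gt1P[x [y [_ _ neq_xy]]] : (1 < #|'I_n|)%N by rewrite card_ord.
  by have [Ex|] := eqVneq x k; [exists y; rewrite -Ex eq_sym | exists x].
(* A monomial whose rim parities are the star at [k] has degree at least n - 2 in [k]. *)
pose A := [set vidx k j | j in ~: [set k; r]].
have sAr : A \subset rim r.
  apply/subsetP => _ /imsetP[j + ->]; rewrite vidx_rim !inE negb_or => /andP[njk njr].
  by rewrite eq_sym njk (eq_sym k) nrk njr.
have NA u : mVdeg u = b -> odd_rim r u != A.
  move=> Vu; apply/eqP => oA; move: lt_bk; rewrite -Vu mnmE Vdeg_row ltnNge.
  case/negP; apply: leq_trans (leq_addr _ _).
  have -> : (n - 2 = \sum_(j in ~: [set k; r]) 1)%N.
    by rewrite sum1_card cardsCs setCK card_ord cards2 eq_sym nrk.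
  rewrite [X in (_ <= X)%N](bigID (mem (~: [set k; r]))) /=.
  apply: leq_trans (leq_addr _ _); apply: leq_sum => j jA.
  have : vidx k j \in odd_rim r u by rewrite oA; apply: imset_f.
  by rewrite in_odd_rim => /andP[_]; case: (u _).
have := rim_coef_inversion q sAr NA.
rewrite (bigD1 (rim_sign (phi l) r)) ?rim_sign_sub //= big1 ?addr0.
  move/eqP; rewrite mulf_eq0 => /orP[|/eqP E].
    rewrite /pairing prodf_seq_eq0 => /hasP[p _].
    by rewrite signr_eq0 andbF.
  by move: b_supp; rewrite mcoeff_msupp (coef_psi_rim q b (phi_diag r l)) E mulr0 eqxx.
move=> T /andP[/rim_sign_surj[i <-] neq_il].
have nil: i != l by apply: contraNneq neq_il => ->.
have /(psi_eq0_rim q (phi_diag r i)) -> := q0 i nil.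
by rewrite mulr0.
Qed.

(** [Q] stands for the twisted generating functions for either parity of n. The second hypothesis
    lets every large multidegree dominate that of a generator. *)
Lemma intersection_genfun (Q : Rpoly F n -> Prop) :
    (forall g, Q g -> exists b P,
      [/\ large_fiber b, fiber_genfun b P & g = twist (phi l) P]) ->
    (forall c : 'X_{1..n}, large_fiber c -> exists b P,
      [/\ large_fiber b, forall k, (b k <= c k)%N, fiber_genfun b P
        & Q (twist (phi l) P)]) ->
  forall q, (forall i, i != l -> twist_img (phi i) (@In F n) q) <->
            ideal_gen (fun g => Jgen g \/ Q g) q.
Proof.
move=> Q_genfun Q_large q.
pose r : 'I_n := Ordinal (ltnW n_ge2).
(* Orthogonality kills a twisted generating function in every component but the l-th. *)
have Q_psi0 i g : i != l -> Jgen g \/ Q g -> psi (phi i) g = 0.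
  move=> neq_il [/Jgen_psi //|/Q_genfun[b [P [bL bP ->]]]].
  rewrite (psi_twist_genfun (phi_diag r i) (phi_diag r l) bL bP).
  case: eqP => [/(@rim_sign_inj r)/eqP|_]; first by rewrite (negbTE neq_il).
  by rewrite mulr0 scale0r.
split=> [q_in|q_in i neq_il]; last first.
  by apply/twist_imgE/(ideal_gen_psi0 (fun g => Q_psi0 i g neq_il)).
have q0 i : i != l -> psi (phi i) q = 0 by move/q_in/twist_imgE.
(* The terms of the l-th image of q are matched one by one by multiples of generators. *)
have cover (bs : seq 'X_{1..n}) : {subset bs <= msupp (psi (phi l) q)} ->
    exists2 h, ideal_gen Q h &
      psi (phi l) h = \sum_(b <- bs) (psi (phi l) q)@_b *: 'X_[b].
  elim: bs => [_|c bs IH sub].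
    exists 0; first by exists [::]; rewrite big_nil.
    by rewrite big_nil -[0 in LHS](scale0r 0) psiZ scale0r.
  have [|h Qh psi_h] := IH; first by move=> b b_bs; rewrite sub // inE b_bs orbT.
  have cL : large_fiber c by apply/(psi_supp_large q0)/sub/mem_head.
  have [b [P [bL le_bc bP QP]]] := Q_large c cL.
  pose B := [multinom b k | k < n].
  have cE : (c - B + B)%MM = c.
    by apply: submK; apply/mnm_lepP => k; rewrite mnmE.
  (* The cofactor needs multidegree c - B, which is attained because its sum is even. *)
  have [w Vw] : exists w, mVdeg w = (c - B)%MM.
    apply: mVdeg_surj; have := cL.2; rewrite -mdegE -{1}cE mdegD oddD.
    suff /negbTE -> : ~~ odd (mdeg B) by rewrite addbF.
    by rewrite mdegE; under eq_bigr => k _ do rewrite mnmE; apply: bL.2.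
  have := psi_twist_genfun (phi_diag r l) (phi_diag r l) bL bP.
  rewrite eqxx -/B; set e := _ * _ * _ => psi_P.
  (* The coefficient is a product of signs and a power of 2. *)
  have nz : sgn F (phi l) w * e != 0.
    apply: mulf_neq0.
      apply/eqP => sgn0; have /eqP := sgnM F (phi l) w.
      by rewrite sgn0 mulr0 eq_sym oner_eq0.
    apply: mulf_neq0; last exact: expf_neq0 two_neq0.
    by apply: mulf_neq0; apply: deg_sign_neq0.
  pose a := (psi (phi l) q)@_c / (sgn F (phi l) w * e).
  exists (a *: 'X_[w] * twist (phi l) P + h).
    by apply: ideal_genD => //; apply: ideal_gen_mull.
  rewrite psiD psiM psiZ psiX Vw psi_P psi_h big_cons; congr (_ + _).
  rewrite -scalerAr -!scalerAl !scalerA -mpolyXD cE; congr (_ *: _).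
  rewrite -[RHS](divfK nz) -/a; ring.
(* Over the whole support, q and h get the same l-th image; both vanish in the other components, so
   q - h lies in J_n. *)
have [h Qh psi_h] := cover _ (fun b => id).
rewrite -mpolyE in psi_h; rewrite -(subrK h q); apply: ideal_genD; last first.
  by apply: ideal_gen_mono Qh; right.
apply: (@ideal_gen_mono _ _ (@Jgen F n)); first by left.
apply/Jn_decomp => i; apply/twist_imgE; rewrite psiB.
have [->|neq_il] := eqVneq i l; first by rewrite psi_h subrr.
have psi_h0 : psi (phi i) h = 0.
  apply: ideal_gen_psi0 Qh => g Qg.
  exact: Q_psi0 neq_il (or_intror Qg).
by rewrite (q0 i neq_il) psi_h0 subrr.
Qed.

End MinimalPrimes.

(** * Degrees and the two parities of n *)

Lemma fiber_genfun_homog (F : fieldType) n (b : 'I_n -> nat) (P : Rpoly F n) :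
  fiber_genfun b P -> homog_deg ((\sum_k b k)./2) P.
Proof.
move=> [S [_ S_b _ _ ->]]; rewrite /homog_deg big_seq rpred_sum // => a aS.
(* The multidegree of each variable has sum 2, so the degree is half the sum of b. *)
rewrite dhomogX /=; apply/eqP/double_inj; rewrite -Vdeg_sum.
under [in RHS]eq_bigr => k _ do rewrite -(S_b _ aS).
by rewrite Vdeg_sum doubleK.
Qed.

Theorem theorem2p10 (F : fieldType) (n : nat) :
  (2 <= n)%N -> ~~ (2%N \in [pchar F]) ->
  forall phi : 'I_(2 ^ 'C(n.-1, 2)) -> 'I_(nv n) -> bool,
  (forall q, Jn q <-> (forall i, twist_img (phi i) (@In F n) q)) ->
  (forall i j, i != j ->
     ~ (forall q, twist_img (phi i) (@In F n) q <-> twist_img (phi j) (@In F n) q)) ->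
  forall l : 'I_(2 ^ 'C(n.-1, 2)),
  (odd n ->
    forall P : 'I_n -> Rpoly F n,
      (forall i, fiber_genfun (fun k => (n - 2 + (k == i))%N) (P i)) ->
      (forall i, homog_deg ((n - 1) ^ 2 %/ 2) (P i)) /\
      (forall q, (forall i, i != l -> twist_img (phi i) (@In F n) q) <->
                 ideal_gen (fun g => Jgen g \/ exists i, g = twist (phi l) (P i)) q)) /\
  (~~ odd n ->
    forall P : Rpoly F n,
      fiber_genfun (fun _ => (n - 2)%N) P ->
      homog_deg (n * (n - 2) %/ 2) P /\
      (forall q, (forall i, i != l -> twist_img (phi i) (@In F n) q) <->
                 ideal_gen (fun g => Jgen g \/ g = twist (phi l) P) q)).
Proof.
move=> n_ge2 char2 phi Jn_decomp phi_distinct l.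
have main := intersection_genfun n_ge2 char2 Jn_decomp phi_distinct.
split=> [odd_n P genP|even_n P genP].
  have sum_b (i : 'I_n) : (\sum_(k < n) (n - 2 + (k == i)) = (n - 1) ^ 2)%N.
    rewrite big_split sum_nat_const card_ord (bigD1 i) //= eqxx big1 => [|k /negbTE-> //].
    (* This is n(n - 2) + 1 = (n - 1)^2; writing n = m + 2 removes the truncated subtractions. *)
    by case: n n_ge2 {phi Jn_decomp phi_distinct l odd_n P genP main i} => [|[|m]] // _; rewrite !subSS !subn0 addn0; nia.
  have large i : large_fiber (fun k : 'I_n => n - 2 + (k == i))%N.
    by split=> [k|]; rewrite ?leq_addr // sum_b oddX oddB ?odd_n // ltnW.
  split=> [i|]; first by rewrite divn2 -(sum_b i); apply: fiber_genfun_homog.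
  apply: main => [g [i ->]|c [ge_c even_c]].
    by exists (fun k => n - 2 + (k == i))%N, (P i).
  (* For odd n the constant vector n - 2 has odd sum, so c, of even sum, exceeds it somewhere. *)
  have [i lt_ci] : exists i, (n - 2 < c i)%N.
    apply/existsP; apply: contraNT even_c => /existsPn le_c.
    rewrite (eq_bigr (fun=> n - 2)%N) => [|k _].
      by rewrite sum_nat_const card_ord oddM oddB // odd_n.
    by apply/eqP; rewrite eqn_leq ge_c andbT leqNgt le_c.
  exists (fun k => n - 2 + (k == i))%N, (P i); split=> //; last by exists i.
  by move=> k; case: eqP => [->|_]; rewrite ?addn1 ?addn0.
have sum_b : (\sum_(k < n) (n - 2) = n * (n - 2))%N.
  by rewrite sum_nat_const card_ord.
(* For even n the constant vector n - 2 is itself large and lies below every large multidegree. *)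
have large : large_fiber (fun _ : 'I_n => n - 2)%N.
  by split=> //; rewrite sum_b oddM (negbTE even_n).
split; first by rewrite divn2 -sum_b; apply: fiber_genfun_homog.
apply: main => [g ->|c [ge_c _]]; first by exists (fun=> n - 2)%N, P.
by exists (fun=> n - 2)%N, P.
Qed.
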